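(* The class of $\{\to\}$-subreducts of subresiduated lattices (viewed as algebras $(A,\to,1)$ of type $(2,0)$) is not a variety.
   Context: A subresiduated lattice is an algebra $(A,\wedge,\vee,\to,0,1)$ of type $(2,2,2,0,0)$ such that $(A,\wedge,\vee,0,1)$ is a bounded distributive lattice and for all $x,y,z\in A$: $x\to x=1$; $x\to y\le z\to(x\to y)$; $x\wedge(x\to y)\le y$; $z\to(x\wedge y)=(z\to x)\wedge(z\to y)$; $(x\vee y)\to z=(x\to z)\wedge(y\to z)$; $(x\to y)\wedge(y\to z)\le x\to z$. A $\{\to\}$-subreduct of a subresiduated lattice $A$ is any isomorphic image of a (nonempty) subalgebra of the reduct $(A,\to)$. Since $1=x\to x$, such a subalgebra always contains $1$, so it is viewed as an algebra of type $(2,0)$ with operations $\to,1$. *)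

(* Defs.v *)
From mathcomp Require Import all_boot all_order.

Set Implicit Arguments.
Unset Strict Implicit.
Unset Printing Implicit Defensive.

Import Order.TTheory.
Local Open Scope order_scope.

Record subresiduated (d : Order.disp_t) (A : tbDistrLatticeType d)
    (imp : A -> A -> A) : Prop := Subresiduated {
  imp_refl : forall x, imp x x = \top;
  imp_open : forall x y z, imp x y <= imp z (imp x y);
  imp_mp : forall x y, x `&` imp x y <= y;
  imp_meetr : forall x y z, imp z (x `&` y) = imp z x `&` imp z y;
  imp_joinl : forall x y z, imp (x `|` y) z = imp x z `&` imp y z;
  imp_trans : forall x y z, imp x y `&` imp y z <= imp x z }.

(* Algebras of type (2,0), with no axioms imposed. *)
Record algebra : Type := Algebra {
  carrier :> Type;
  arrow : carrier -> carrier -> carrier;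
  one : carrier }.

Arguments one {a}.

Definition homomorphism (A B : algebra) (f : A -> B) : Prop :=
  (forall x y : A, f (arrow x y) = arrow (f x) (f y)) /\ f one = one.

Definition surjective (A B : Type) (f : A -> B) : Prop :=
  forall y, exists x, f x = y.

Definition isomorphic (A B : algebra) : Prop :=
  exists f : A -> B, [/\ homomorphism f, injective f & surjective f].

Record subuniverse (A : algebra) : Type := Subuniverse {
  mem_sub :> A -> Prop;
  sub_arrow : forall x y, mem_sub x -> mem_sub y -> mem_sub (arrow x y);
  sub_one : mem_sub one }.

Definition subalgebra (A : algebra) (S : subuniverse A) : algebra :=
  @Algebra {x : A | S x}
    (fun x y => exist _ (arrow (sval x) (sval y))
                        (sub_arrow (svalP x) (svalP y)))
    (exist _ one (sub_one S)).

Definition product (I : Type) (A : I -> algebra) : algebra :=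
  @Algebra (forall i, A i) (fun x y i => arrow (x i) (y i)) (fun i => one).

(* Closure under isomorphic copies is the special case of [var_H] where the
   homomorphism is bijective; nonemptiness is the case of an empty index type
   in [var_P]. *)
Record variety (K : algebra -> Prop) : Prop := Variety {
  var_H : forall (A B : algebra) (f : A -> B),
    homomorphism f -> surjective f -> K A -> K B;
  var_S : forall (A : algebra) (S : subuniverse A), K A -> K (subalgebra S);
  var_P : forall (I : Type) (A : I -> algebra),
    (forall i, K (A i)) -> K (product A) }.

Definition reduct (d : Order.disp_t) (A : tbDistrLatticeType d)
    (imp : A -> A -> A) : algebra := @Algebra A imp \top.

(* Since [imp x x = \top], the subuniverses of [reduct imp] are exactly the
   nonempty subsets of [A] closed under [imp]. *)
Definition subreduct (B : algebra) : Prop :=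
  exists (d : Order.disp_t) (A : tbDistrLatticeType d) (imp : A -> A -> A),
    subresiduated imp /\
    exists S : subuniverse (reduct imp), isomorphic B (subalgebra S).

(* Main.v *)
From Stdlib Require Import ProofIrrelevance.
From mathcomp Require Import all_boot all_order.
Require Import Defs.

(** Every subreduct satisfies the quasi-identity
    [x -> y = 1 = y -> x  ==>  x = y], since [x -> y = 1] means [x <= y].
    On a bounded distributive lattice with more than two elements, the
    two-valued implication [x -> y = 1] if [x <= y], and [0] otherwise, is
    subresiduated.  As every arrow lies in [{0, 1}], sending [0] and [1] to
    [1] and all the other elements to a single second element is a
    homomorphism onto an algebra where every arrow equals [1], and there the
    quasi-identity fails. *)

Import Order.TTheory.
Local Open Scope order_scope.

(** The largest [c] among [\bot] and [\top] with [x]&[c <= y]: residuation relative to the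
    sublattice of the two bounds. *)
Definition two_valued_imp {d : Order.disp_t} {A : tbDistrLatticeType d}
    (x y : A) : A :=
  if x <= y then \top else \bot.

Lemma two_valued_imp_subresiduated (d : Order.disp_t)
    (A : tbDistrLatticeType d) : subresiduated (@two_valued_imp d A).
Proof.
split; rewrite /two_valued_imp.
- by move=> x; rewrite lexx.
- by move=> x y z; case: (x <= y); [rewrite lex1 | exact: le0x].
- by move=> x y; case: ifP => [|_]; rewrite ?meetx1 // meetx0 le0x.
- move=> x y z; rewrite lexI.
  by case: (z <= x) (z <= y) => [] [] /=; rewrite ?meet1x ?meet0x.
- move=> x y z; rewrite leUx.
  by case: (x <= z) (y <= z) => [] [] /=; rewrite ?meet1x ?meet0x.
- move=> x y z.
  case: (boolP (x <= y)) => [xy|_]; last by rewrite meet0x le0x.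
  case: (boolP (y <= z)) => [yz|_]; last by rewrite meetx0 le0x.
  by rewrite (le_trans xy yz) lex1.
Qed.

Definition full_subuniverse (A : algebra) : subuniverse A :=
  @Subuniverse A (fun _ => True) (fun _ _ _ _ => I) I.

Lemma isomorphic_full (A : algebra) :
  isomorphic A (subalgebra (full_subuniverse A)).
Proof.
exists (fun x => exist _ x I); split=> [//|x y [] //|[x []]].
by exists x.
Qed.

Lemma reduct_subreduct (d : Order.disp_t) (A : tbDistrLatticeType d)
    (imp : A -> A -> A) : subresiduated imp -> subreduct (reduct imp).
Proof.
move=> Himp; exists d, A, imp; split=> //.
by exists (full_subuniverse (reduct imp)); apply: isomorphic_full.
Qed.

Lemma subreduct_arrow_antisym (B : algebra) (x y : B) :
  subreduct B -> arrow x y = one -> arrow y x = one -> x = y.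
Proof.
move=> [d [A [imp [Himp [S [f [[fM f1] f_inj _]]]]]]] xy yx.
have le_f u v : arrow u v = one -> sval (f u) <= sval (f v).
  move=> uv; have := congr1 sval (fM u v); rewrite uv f1 /= => top_eq.
  (* With the implication equal to [\top], modus ponens reads [u]&[\top <= v] on the images. *)
  by have := imp_mp Himp (sval (f u)) (sval (f v)); rewrite -top_eq meetx1.
have fxy : sval (f x) = sval (f y) by apply: le_anti; rewrite !le_f.
apply: f_inj; case: (f x) (f y) fxy => [a Sa] [b Sb] /= ab.
exact: subset_eq_compat.
Qed.

Definition constant_arrow_algebra : algebra :=
  @Algebra bool (fun _ _ => true) true.

Lemma constant_arrow_not_subreduct : ~ subreduct constant_arrow_algebra.
Proof.
move=> sub.
by have := @subreduct_arrow_antisym constant_arrow_algebra true false sub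
  erefl erefl.
Qed.

Lemma collapse_bounds_homomorphism (d : Order.disp_t)
    (A : tbDistrLatticeType d) :
  @homomorphism (reduct (@two_valued_imp d A)) constant_arrow_algebra
    (fun x : A => (x == \bot) || (x == \top)).
Proof.
split=> [x y|] /=; last by rewrite eqxx orbT.
by rewrite /two_valued_imp; case: ifP => _; rewrite eqxx ?orbT.
Qed.

Theorem lemma3p1 : ~ variety subreduct.
Proof.
move=> [closedH _ _]; apply: constant_arrow_not_subreduct.
(* The four-element Boolean lattice has elements besides its bounds, such as [(true, false)]; these
   are sent to [false], which makes the map onto. *)
apply: (closedH _ _ _ (@collapse_bounds_homomorphism _ (bool *p bool)%type)).
  by case; [exists \top | exists (true, false)].
exact/reduct_subreduct/two_valued_imp_subresiduated.
Qed.
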